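(* Let $G$ be a finite simple graph with no isolated vertices. Then $B(G)\leq Z(L(G))$.
   Context: For a finite simple graph $H$: colour each vertex black or white. A black vertex $v$ may force a white neighbour $w$ to become black if $w$ is the only white neighbour of $v$. A set $S\subseteq V(H)$ is a zero-forcing set if, colouring exactly the vertices of $S$ black and repeatedly applying this rule, all vertices eventually become black. The zero-forcing number $Z(H)$ is the minimum size of a zero-forcing set (and $Z$ of the graph with no vertices is $0$). Brushing: initially every vertex and every edge of $G$ is dirty. An initial configuration places a nonnegative integer number of brushes at each vertex. At each step a single remaining vertex $v$ fires; $v$ may fire only if the number of brushes currently at $v$ is at least the number of dirty edges currently incident with $v$. When $v$ fires, $v$ becomes clean, and each dirty edge incident with $v$ is traversed by at least one brush (distinct brushes for distinct edges; several brushes may traverse the same edge), which cleans that edge and moves those brushes to its other endpoint; excess brushes may remain at $v$ but play no further role; $v$ and its incident edges are then removed. The process ends when no vertex can fire. A configuration cleans $G$ if some such process cleans all vertices and edges. $B(G)$ is the minimum total number of brushes in a configuration that cleans $G$. $L(G)$ denotes the line graph of $G$: its vertices are the edges of $G$, two being adjacent iff they share an endpoint in $G$. *)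

(* Defs.v *)
From mathcomp Require Import all_boot.
From mathcomp Require Import boolp.
From Stdlib Require Import Relation_Operators.

Set Implicit Arguments.
Unset Strict Implicit.
Unset Printing Implicit Defensive.

Record sgraph := SGraph {
  vertex :> finType;
  adj : rel vertex;
  adj_sym : symmetric adj;
  adj_irrefl : irreflexive adj }.

Definition no_isolated (G : sgraph) : Prop :=
  forall v : G, exists w : G, adj v w.

Definition edges (G : sgraph) : {set {set G}} :=
  [set A | [exists x : G, exists y : G, adj x y && (A == [set x; y])]].

Definition edge_type (G : sgraph) : finType := {A : {set G} | A \in edges G}.

Definition line_adj (G : sgraph) : rel (edge_type G) :=
  fun A B => (A != B) && [exists x : G, (x \in val A) && (x \in val B)].

Lemma line_adj_sym (G : sgraph) : symmetric (@line_adj G).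
Proof.
move=> A B; rewrite /line_adj eq_sym; congr (_ && _).
by apply: eq_existsb => x; rewrite andbC.
Qed.

Lemma line_adj_irrefl (G : sgraph) : irreflexive (@line_adj G).
Proof. by move=> A; rewrite /line_adj eqxx. Qed.

Definition line_graph (G : sgraph) : sgraph :=
  SGraph (@line_adj_sym G) (@line_adj_irrefl G).

Section ZeroForcing.
Variable H : sgraph.

Definition may_force (S : {set H}) (v w : H) : bool :=
  [&& v \in S, w \notin S, adj v w
    & [forall u : H, adj v u && (u \notin S) ==> (u == w)]].

Definition force_step : rel {set H} :=
  fun S S' => [exists v : H, exists w : H, may_force S v w && (S' == w |: S)].

Definition zero_forcing (S : {set H}) : bool := connect force_step S [set: H].

Lemma zero_forcingT : zero_forcing [set: H].
Proof. exact: connect0. Qed.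

(* A genuine minimum, by zero_forcingT. *)
Definition zero_forcing_number : nat :=
  #|[arg min_(S < [set: H] | zero_forcing S) #|S| ]|.

End ZeroForcing.

Section Brushing.
Variable G : sgraph.

(* A vertex is removed exactly when it becomes clean, so the remaining         *)
(* vertices are the dirty ones, and likewise for edges.                        *)
Record brush_state := BrushState {
  dirty_vertices : {set G};
  dirty_edges : {set {set G}};
  brushes : {ffun G -> nat} }.

Definition brush_init (b : {ffun G -> nat}) : brush_state :=
  BrushState [set: G] (edges G) b.

Definition dirty_at (s : brush_state) (v : G) : {set {set G}} :=
  [set A in dirty_edges s | v \in A].

(* t A is the number of brushes sent along the dirty edge A when v fires; the  *)
(* excess stays at v.                                                          *)
Definition after_fire (s : brush_state) (v : G) (t : {set G} -> nat) :=
  BrushState (dirty_vertices s :\ v) (dirty_edges s :\: dirty_at s v)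
    [ffun w => if w == v then brushes s v - \sum_(A in dirty_at s v) t A
               else brushes s w + \sum_(A in dirty_at s v | w \in A) t A].

Inductive fires (s : brush_state) : brush_state -> Prop :=
  Fires (v : G) (t : {set G} -> nat) of
      v \in dirty_vertices s
    & #|dirty_at s v| <= brushes s v
    & (forall A, A \in dirty_at s v -> 0 < t A)
    & \sum_(A in dirty_at s v) t A <= brushes s v
    : fires s (after_fire s v t).

Definition cleans (b : {ffun G -> nat}) : Prop :=
  exists s : brush_state,
    [/\ clos_refl_trans_1n brush_state fires (brush_init b) s,
        dirty_vertices s = set0 & dirty_edges s = set0].

Definition cleanable_with (k : nat) : Prop :=
  exists2 b : {ffun G -> nat}, cleans b & \sum_(v : G) b v = k.

Lemma fire_all (n : nat) (s : brush_state) :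
  #|dirty_vertices s| = n ->
  (forall v, v \in dirty_vertices s -> #|dirty_at s v| <= brushes s v) ->
  (forall A, A \in dirty_edges s -> exists2 x, x \in dirty_vertices s & x \in A) ->
  exists s' : brush_state,
    [/\ clos_refl_trans_1n brush_state fires s s',
        dirty_vertices s' = set0 & dirty_edges s' = set0].
Proof.
elim: n s => [|n IHn] s.
  move=> /eqP; rewrite cards_eq0 => /eqP s0 _ sD; exists s; split=> //.
    exact: rt1n_refl.
  by apply/setP=> A; rewrite inE; apply/negP=> /sD[x]; rewrite s0 inE.
move=> sn sb sD; have /card_gt0P[v vs] : 0 < #|dirty_vertices s| by rewrite sn.
have [|w|A|s' [ss' s'v s'e]] := IHn (after_fire s v (fun=> 1)).
- by move: sn; rewrite (cardsD1 v) vs => -[].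
- rewrite !inE ffunE => /andP[/negPf -> ws].
  apply: leq_trans (leq_addr _ _); apply: leq_trans (sb w ws).
  by apply/subset_leq_card/subsetP=> A; rewrite !inE => /andP[/andP[_ ->] ->].
- rewrite !inE => /andP[nA As]; have [x xs xA] := sD A As.
  exists x => //; rewrite !inE xs andbT; apply: contraNneq nA => <-.
  by rewrite As.
exists s'; split=> //; apply: rt1n_trans ss'.
by constructor; rewrite ?sum1_card ?sb.
Qed.

Lemma exists_cleanable : exists k, `[< cleanable_with k >].
Proof.
exists (\sum_(v : G) [ffun=> #|edges G|] v); apply/asboolP.
eexists; last by [].
apply: (@fire_all #|G|); first by rewrite cardsT.
- move=> v _; rewrite ffunE; apply/subset_leq_card/subsetP=> A.
  by rewrite inE => /andP[].
- move=> A; rewrite inE => /existsP[x /existsP[y /andP[_ /eqP->]]].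
  by exists x; rewrite !inE ?eqxx.
Qed.

Definition brush_number : nat := ex_minn exists_cleanable.

End Brushing.

(* Main.v *)
Require Import Defs.
From mathcomp Require Import all_boot.
From mathcomp Require Import boolp.
From Stdlib Require Import Relation_Operators.

(** List the vertices of [G] by the moment at which all their edges are black,
    and orient each edge away from its endpoint listed first. If the edge [e]
    forces the edge [f] through their common vertex [v], then the other end of
    [e] is already all black, [v] becomes all black at this very step, and the
    other end of [f] does so no earlier (in case of a tie, [v] is listed first);
    so [e] enters [v] and [f] leaves it. Hence, at every vertex, the outgoing
    edges are at most as many as the incoming ones together with the outgoing
    edges of the forcing set: one brush at the tail of each edge of the forcing
    set suffices when the vertices fire in this order. *)

Set Implicit Arguments.
Unset Strict Implicit.
Unset Printing Implicit Defensive.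

Section EarlierVertices.
Variable T : finType.
Implicit Types (s : seq T) (x v : T) (A : {set T}).

(* For an edge [A] at [x] and a firing order [s]: [A] is oriented into [x]. *)
Definition earlier s x A := [exists y in A, index y s < index x s].

Lemma earlier_cons v s x A :
  x != v -> earlier (v :: s) x A = (v \in A) || earlier s x A.
Proof.
move=> xv; apply/existsP/orP => [[y /andP[yA]] | [vA | /existsP[y /andP[yA lt]]]].
- rewrite /= [v == x]eq_sym (negPf xv); case: eqVneq => [->|_ lt]; first by left.
  by right; apply/existsP; exists y; rewrite yA.
- by exists v; rewrite vA /= eqxx eq_sym (negPf xv).
- exists y; rewrite yA /= [v == x]eq_sym (negPf xv).
  by case: eqVneq.
Qed.

Lemma earlier_head v s A : earlier (v :: s) v A = false.
Proof. by apply/existsP => -[y /andP[_]]; rewrite /= eqxx ltn0. Qed.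

(** The index of each is at most that of the other: an edge has a single tail. *)
Lemma not_earlier_inj s A x y : x \in s -> y \in s -> x \in A -> y \in A ->
  ~~ earlier s x A -> ~~ earlier s y A -> x = y.
Proof.
move=> xs ys xA yA; rewrite !negb_exists => /forallP/(_ y) + /forallP/(_ x).
rewrite xA yA /= -!leqNgt => le1 le2.
by apply: (index_inj x xs ys); apply/eqP; rewrite eqn_leq le1 le2.
Qed.

End EarlierVertices.

Section FiringInOrder.
Variable G : sgraph.

(** Each firing sends exactly one brush along every dirty edge, so when the turn of [x] comes, every
    incoming edge has brought it a brush and only its outgoing edges are still dirty. *)
Lemma fire_in_order (r : seq G) (s : brush_state G) :
  uniq r -> dirty_vertices s = [set x in r] ->
  (forall A, A \in dirty_edges s -> exists2 x, x \in r & x \in A) ->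
  (forall x, x \in r ->
     #|[set A in dirty_at s x | ~~ earlier r x A]|
       <= brushes s x + #|[set A in dirty_at s x | earlier r x A]|) ->
  exists s' : brush_state G,
    [/\ clos_refl_trans_1n _ (@fires G) s s',
        dirty_vertices s' = set0 & dirty_edges s' = set0].
Proof.
elim: r s => [|v r IHr] s.
  move=> _ s0 sD _; exists s; split; first exact: rt1n_refl.
    by rewrite s0; apply/setP=> x; rewrite !inE.
  by apply/setP=> A; rewrite inE; apply/negP=> /sD[].
move=> /= /andP[vr ur] sV sD sb.
(* Nothing precedes [v], so all its dirty edges count as outgoing. *)
have vb : #|dirty_at s v| <= brushes s v.
  have := sb v (mem_head v r).
  have -> : [set A in dirty_at s v | ~~ earlier (v :: r) v A] = dirty_at s v.
    by apply/setP=> A; rewrite !inE earlier_head andbT.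
  have -> : [set A in dirty_at s v | earlier (v :: r) v A] = set0.
    by apply/setP=> A; rewrite !inE earlier_head andbF.
  by rewrite cards0 addn0.
have [||A|x xr|s' [ss' s'V s'D]] := IHr (after_fire s v (fun=> 1)) => //.
- rewrite /= sV; apply/setP=> x; rewrite !inE.
  by case: eqVneq => // ->; rewrite (negPf vr).
- rewrite !inE => /andP[nA As]; have [x] := sD A As.
  rewrite inE => /predU1P[-> vA|]; last by exists x.
  by rewrite As vA in nA.
- have xv : x != v by apply: contraNneq vr => <-.
  have := sb x; rewrite inE xr orbT => /(_ isT).
  rewrite /= ffunE (negPf xv) sum1dep_card -addnA.
  set In := [set A in dirty_at s x | earlier (v :: r) x A].
  (* Of the edges entering [x], those through [v] have just delivered a brush; the others are still
     to come. *)
  rewrite -(cardsID [set A : {set G} | v \in A] In).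
  congr (_ <= _ + (_ + _)); apply: eq_card => A;
    rewrite !inE ?earlier_cons // ?negb_or;
    by case: (A \in _); case: (v \in A); case: (x \in A); case: earlier.
exists s'; split=> //; apply: rt1n_trans ss'.
by constructor; rewrite ?sum1_card // sV inE mem_head.
Qed.

End FiringInOrder.

Section ForcingOrder.
Variable G : sgraph.
Implicit Types (S : {set line_graph G}) (e f g : line_graph G) (s : seq G).

Definition in_edges s x :=
  [set e : line_graph G | (x \in val e) && earlier s x (val e)].
Definition out_edges s x :=
  [set e : line_graph G | (x \in val e) && ~~ earlier s x (val e)].

Definition all_black S :=
  [set x : G | [forall e : line_graph G, (x \in val e) ==> (e \in S)]].

Lemma all_blackP S x :
  reflect (forall e, x \in val e -> e \in S) (x \in all_black S).
Proof. by rewrite inE; apply: (iffP forallP) => H e; apply/implyP/H. Qed.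

Lemma card_edge e : #|val e| = 2.
Proof.
case: e => A /=; rewrite inE => /existsP[x /existsP[y /andP[xy /eqP->]]].
rewrite cards2; case: eqVneq xy => // ->.
by rewrite adj_irrefl.
Qed.

Lemma edge_notin e f : e != f -> exists2 u, u \in val e & u \notin val f.
Proof.
move=> ef; apply/subsetPn; apply: contra ef => sub.
by apply/eqP/val_inj/eqP; rewrite eqEcard sub !card_edge.
Qed.

(** Induction on the forcing steps, for any listing [l] of the vertices all black so far, so that
    the order only grows at its end. Once every edge is black, [S] contains all outgoing edges. *)
Lemma zero_forcing_order S l : zero_forcing S ->
  uniq l -> l =i all_black S ->
  exists r, [/\ uniq (l ++ r), forall x, x \in l ++ r &
    forall x, #|out_edges (l ++ r) x|
      <= #|S :&: out_edges (l ++ r) x| + #|in_edges (l ++ r) x|].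
Proof.
move=> /connectP[p]; elim: p S l => [|S' p IHp] S l /=.
  move=> _ <- ul lE; exists [::]; rewrite cats0; split=> // x.
    by rewrite lE; apply/all_blackP.
  by rewrite setTI leq_addr.
move=> /andP[/existsP[e /existsP[f /andP[ef /eqP->]]] pS] pT ul lE.
case/and4P: ef => eS fS /andP[nef /existsP[v /andP[ve vf]]] /forallP uniqf.
have [u ue uf] := edge_notin nef.
(* [f] is the only white neighbour of [e] in the line graph, so every other edge meeting [e] is
   black. *)
have nbr g x : x \in val e -> x \in val g -> g != f -> g \in S.
  move=> xe xg gf; case: (eqVneq g e) => [->//|ge].
  apply: contraNT gf => gS; have := uniqf g; rewrite gS andbT.
  move/implyP; apply; apply/andP; split; first by rewrite eq_sym.
  by apply/existsP; exists x; rewrite xe.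
have ul_u : u \in l.
  rewrite lE; apply/all_blackP=> g ug; apply: (nbr g u) => //.
  by apply: contraNneq uf => <-.
have l_f x : x \in val f -> x \notin l.
  by move=> xf; rewrite lE; apply: contra fS => /all_blackP->.
have vl := l_f v vf.
have sub : all_black S \subset all_black (f |: S).
  by apply/subsetP=> x /all_blackP xS; apply/all_blackP=> g /xS; rewrite !inE orbC => ->.
have vS' : v \in all_black (f |: S).
  apply/all_blackP=> g vg; rewrite !inE; case: eqVneq => //= gf.
  exact: (nbr g v).
(* [v] goes first among the newly all black vertices, so that [f] leaves [v] even if its other end
   is one of them. *)
have [||r] := IHp _ (l ++ v :: enum (all_black (f |: S) :\: (v |: all_black S))) pS pT.
- rewrite cat_uniq ul /= (negPf vl) enum_uniq mem_enum in_setD in_setU1 eqxx /= andbT.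
  by apply/hasPn=> x; rewrite mem_enum in_setD in_setU1 -lE negb_or => /andP[/andP[]].
- move=> x; rewrite mem_cat inE mem_enum in_setD in_setU1 lE negb_or.
  case: (eqVneq x v) => [->|_] /=; first by rewrite vS' orbT.
  by case: (boolP (x \in all_black S)) => //= /(subsetP sub) ->.
rewrite -catA cat_cons; set r' := v :: _; move=> [us alls sP].
exists r'; split=> // x.
have iv : index v (l ++ r') = size l.
  by rewrite index_cat (negPf vl) /= eqxx addn0.
case: (eqVneq x v) => [->|xv]; last first.
  (* If [x] is the other end of [f], then [v] precedes it and [f] enters [x]; so blackening [f]
     changes nothing at [x]. *)
  suff -> : S :&: out_edges (l ++ r') x = (f |: S) :&: out_edges (l ++ r') x.
    exact: sP.
  apply/setP=> g; rewrite !inE; case: eqVneq => //= -> .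
  rewrite (negPf fS) /=; apply/esym/negP=> /andP[xf /existsP[]].
  exists v; rewrite vf iv index_cat (negPf (l_f x xf)) /=.
  by rewrite eq_sym (negPf xv) addnS ltnS leq_addr.
(* At [v], only [f] can leave without lying in [S]; the edge [e], which enters from [u] in [l],
   makes up for it. *)
rewrite addnC; apply: (@leq_trans #|f |: (S :&: out_edges (l ++ r') v)|).
  apply/subset_leq_card/subsetP=> g; rewrite !inE => /andP[vg ->].
  by case: eqVneq => //= gf; rewrite vg (nbr g v).
rewrite cardsU1 leq_add //; apply: leq_trans (leq_b1 _) _.
apply/card_gt0P; exists e; rewrite inE ve; apply/existsP; exists u.
by rewrite ue iv index_cat ul_u index_mem.
Qed.

(** Brushing treats edges as vertex sets, forcing as elements of a subtype; the injection [val]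
    carries the counts over. *)
Lemma card_edges_pred (P : pred {set G}) :
  #|[set A in edges G | P A]| = #|[set e : line_graph G | P (val e)]|.
Proof.
rewrite -[RHS](card_imset _ val_inj); apply: eq_card => A.
rewrite inE; apply/andP/imsetP => [[AE PA]|[e + ->]]; last by rewrite inE (valP e).
by exists (Sub A AE : edge_type G); rewrite ?inE SubK.
Qed.

(** Double counting: each edge of [S] is counted only at its tail. *)
Lemma sum_out_edges S s : (forall x, x \in s) ->
  \sum_(x : G) #|S :&: out_edges s x| <= #|S|.
Proof.
move=> alls; under eq_bigr do rewrite -sum1_card.
rewrite (exchange_big_dep (mem S)) /=; last by move=> x e _ /setIP[].
rewrite -sum1_card; apply: leq_sum => e eS.
rewrite sum1dep_card; apply/card_le1_eqP=> x y.
rewrite !inE => /andP[_ /andP[xe nx]] /andP[_ /andP[ye ny]].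
exact: not_earlier_inj (alls y) (alls x) ye xe ny nx.
Qed.

Lemma brush_number_le (b : {ffun G -> nat}) :
  cleans b -> brush_number G <= \sum_(v : G) b v.
Proof.
move=> bC; rewrite /brush_number; case: ex_minnP => m _; apply.
by apply/asboolP; exists b.
Qed.

Lemma brush_number_zero_forcing S : zero_forcing S -> brush_number G <= #|S|.
Proof.
move=> zS.
have [||r []] := zero_forcing_order (l := enum (all_black S)) zS.
- exact: enum_uniq.
- exact: mem_enum.
set s := _ ++ r => us alls sP; apply: leq_trans (sum_out_edges S alls).
(* The configuration: at [x], one brush for every edge of [S] that leaves [x]. *)
rewrite -(eq_bigr _ (fun x _ => ffunE (fun x => #|S :&: out_edges s x|) x)).
apply: brush_number_le; apply: (fire_in_order us) => /= [|A|x _].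
- by apply/setP=> x; rewrite !inE alls.
- rewrite inE => /existsP[x /existsP[y /andP[_ /eqP->]]].
  by exists x; rewrite ?alls // !inE eqxx.
rewrite ffunE; have := sP x.
rewrite -(card_edges_pred (fun A => (x \in A) && ~~ earlier s x A)).
rewrite -(card_edges_pred (fun A => (x \in A) && earlier s x A)).
by congr (_ <= _ + _); apply: eq_card => A; rewrite !inE andbA.
Qed.

End ForcingOrder.

Theorem theorem1 (G : sgraph) (hG : no_isolated G) :
  brush_number G <= zero_forcing_number (line_graph G).
Proof.
rewrite /zero_forcing_number; case: arg_minnP => [|S zS _].
  exact: zero_forcingT.
exact: brush_number_zero_forcing.
Qed.
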